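(* Let $k\ge 1$, $\ell\ge 1$, $1\le i\le j\le \ell$, and let $(x_0,\dots,x_\ell\mid x_{\ell+1})$ be a state such that $x_i,x_j\ge 1$ (and $x_i\ge 2$ if $i=j$). Let $1\le a\le \min\{i,\ell-j+1\}$. Then, except for the case where $\sum_{m=0}^{\ell}x_m=2$ and $a=\ell-j+1$, $$RU_\ell^k(x_0,\dots,x_i,\dots,x_j,\dots,x_\ell\mid x_{\ell+1})\le RU_\ell^k(x_0,\dots,x_{i-a}+1,\dots,x_i-1,\dots,x_j-1,\dots,x_{j+a}+1,\dots,x_\ell\mid x_{\ell+1}).$$ Here the state on the right-hand side is obtained from $(x_0,\dots,x_\ell\mid x_{\ell+1})$ by adding $1$ to the components with indices $i-a$ and $j+a$ and subtracting $1$ from the components with indices $i$ and $j$ (so if $i=j$ the $i$-th component decreases by $2$, and if $j+a=\ell+1$ then it is $x_{\ell+1}$ that increases by $1$).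
   Context: Bounded Rényi–Ulam game (adaptive). The Responder thinks of an element of a finite set and the Questioner has to find it. In each round the Questioner asks whether the sought element lies in a chosen subset with at most $k$ elements ($k\ge1$), and the Responder immediately answers YES or NO; the Responder may lie at most $\ell$ times in total. An element is said to receive a NO in a round if the answer is NO and the element is in the queried set, or the answer is YES and the element is not in the queried set. The state of the game is described by a vector of nonnegative integers $(x_0,\dots,x_\ell)$, also written $(x_0,\dots,x_\ell\mid x_{\ell+1})$: for $0\le i\le \ell$, $x_i$ is the number of elements that have received exactly $i$ NOs (these elements form the $i$-th component), and $x_{\ell+1}$ is the number of elements that have received at least $\ell+1$ NOs. The latter elements are excluded from the search, since the sought element cannot be one of them (so at least one element is always non-excluded). A query is described by $(q_0,\dots,q_\ell)$ with $0\le q_i\le x_i$ and $\sum_i q_i\le k$, where $q_i$ is the number of queried elements of the $i$-th component. After a YES the new state is $(q_0,\,q_1+(x_0-q_0),\dots,q_\ell+(x_{\ell-1}-q_{\ell-1}))$; after a NO it is $(x_0-q_0,\,(x_1-q_1)+q_0,\dots,(x_\ell-q_\ell)+q_{\ell-1})$. The game ends exactly when $\sum_{i=0}^{\ell}x_i=1$. $RU_\ell^k(x_0,\dots,x_\ell)=RU_\ell^k(x_0,\dots,x_\ell\mid x_{\ell+1})$ denotes the minimum number of queries with which the Questioner can surely (in the worst case) end the game from the starting state $(x_0,\dots,x_\ell\mid x_{\ell+1})$. *)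

(* Defs.v *)
From mathcomp Require Import all_boot.
Set Implicit Arguments.
Unset Strict Implicit.
Unset Printing Implicit Defensive.

(* The last component, of index l.+1, counts the excluded elements. *)
Definition state (l : nat) := {ffun 'I_l.+2 -> nat}.

Definition live (l : nat) (x : state l) : nat := \sum_(m < l.+1) x (inord m).

(* Entries are taken in 'I_k.+1 because the size bound in [legal_query] forces
   them to be at most k anyway; this makes the set of queries finite. *)
Definition query (k l : nat) := {ffun 'I_l.+1 -> 'I_k.+1}.

Definition legal_query (k l : nat) (x : state l) (q : query k l) : bool :=
  [forall m : 'I_l.+1, q m <= x (inord m)] && (\sum_(m < l.+1) q m <= k).

Definition yes_state (k l : nat) (x : state l) (q : query k l) : state l :=
  [ffun m : 'I_l.+2 =>
     (if m <= l then q (inord m) : nat else x m)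
     + (if 0 < m then x (inord m.-1) - q (inord m.-1) else 0)].

Definition no_state (k l : nat) (x : state l) (q : query k l) : state l :=
  [ffun m : 'I_l.+2 =>
     (if m <= l then x m - q (inord m) else x m)
     + (if 0 < m then q (inord m.-1) : nat else 0)].

Definition answer_state (k l : nat) (x : state l) (q : query k l) (b : bool) :=
  if b then yes_state x q else no_state x q.

(* The Questioner can surely end the game from x with at most n queries.  The
   Responder may not give an answer that would exclude every element. *)
Fixpoint can_end (k l n : nat) (x : state l) {struct n} : bool :=
  (live x == 1) ||
  (if n is n'.+1 then
     [exists q : query k l, legal_query x q &&
        [forall b : bool, (0 < live (answer_state x q b)) ==>
           can_end k n' (answer_state x q b)]]
   else false).

(* Number of further NOs the elements can absorb altogether.  While two of
   them are live, querying a single live element lowers it whatever the answer. *)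
Definition weight (l : nat) (x : state l) : nat :=
  \sum_(m < l.+1) (l.+1 - m) * x (inord m).

Lemma weight_split (l : nat) (f g : nat -> nat) (x : state l) :
  (forall m : 'I_l.+2, m <= l ->
     x m = f m + (if 0 < m then g m.-1 else 0)) ->
  weight x = \sum_(m < l.+1) (l.+1 - m) * f m + \sum_(m < l.+1) (l - m) * g m.
Proof.
move=> xE; rewrite /weight.
rewrite (eq_bigr (fun m : 'I_l.+1 => (l.+1 - m) * f m
            + (l.+1 - m) * (if 0 < m then g m.-1 else 0))); last first.
  move=> m _; have mlt : m < l.+2 by rewrite ltnS ltnW.
  by rewrite -mulnDr xE inordK // -ltnS.
rewrite big_split /=; congr (_ + _).
rewrite big_ord_recl /= muln0 add0n big_ord_recr /= subnn mul0n addn0.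
by apply: eq_bigr => m _; rewrite /bump /= add1n subSS.
Qed.

Lemma weight_yes (k l : nat) (x : state l) (q : query k l) :
  legal_query x q ->
  weight (yes_state x q) + \sum_(m < l.+1) (x (inord m) - q m) = weight x.
Proof.
case/andP=> /forallP qx _.
rewrite (@weight_split l (fun m => q (inord m))
           (fun m => x (inord m) - q (inord m))); last first.
  by move=> m ml; rewrite ffunE ml.
rewrite /weight -!big_split /=; apply: eq_bigr => m _.
rewrite inord_val (subSn (leq_ord m)).
have := subnKC (qx m); set c := l - m; set d := _ - _ => <-.
by rewrite mulnDr -addnA; congr (_ + _); rewrite mulSn addnC.
Qed.

Lemma weight_no (k l : nat) (x : state l) (q : query k l) :
  legal_query x q ->
  weight (no_state x q) + \sum_(m < l.+1) q m = weight x.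
Proof.
case/andP=> /forallP qx _.
rewrite (@weight_split l (fun m => x (inord m) - q (inord m))
           (fun m => q (inord m))); last first.
  by move=> m ml; rewrite ffunE ml inord_val.
rewrite /weight -!big_split /=; apply: eq_bigr => m _.
rewrite inord_val (subSn (leq_ord m)).
have := subnK (qx m); set c := l - m; set d := _ - _ => <-.
by rewrite mulnDr -addnA; congr (_ + _); rewrite mulSn addnC.
Qed.

Lemma can_end_weight (k l n : nat) (x : state l) :
  0 < k -> 0 < live x -> weight x <= n -> can_end k n x.
Proof.
move=> k0; elim: n x => [|n IHn] x x0 wx.
  have : live x <= weight x.
    rewrite /weight; apply: leq_sum => m _.
    by rewrite leq_pmull // subn_gt0.
  by move/leq_trans/(_ wx); rewrite leqn0 => /eqP xE; rewrite xE in x0.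
rewrite /=; case: eqP => //= /eqP live1.
have [m xm] : exists m : 'I_l.+1, 0 < x (inord m).
  apply/existsP; move: x0; apply: contraLR; rewrite negb_exists => /forallP xN.
  by rewrite -leqNgt leqn0 /live big1 // => m _; move: (xN m); case: (x _).
pose q : query k l := [ffun m' => if m' == m then inord 1 else ord0].
have qE m' : q m' = (m' == m) :> nat.
  by rewrite ffunE; case: eqP => // _; rewrite inordK.
have sq : \sum_(m' < l.+1) q m' = 1.
  rewrite (eq_bigr _ (fun m' _ => qE m')) (bigD1 m) //= eqxx big1 ?addn0 //.
  by move=> m' /negbTE ->.
have qx : legal_query x q.
  rewrite /legal_query sq k0 andbT; apply/forallP=> m'; rewrite qE.
  by case: eqP => // ->.
apply/existsP; exists q; rewrite qx; apply/forallP=> b; apply/implyP=> b0.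
apply: IHn => //; case: b b0 => _ /=; last first.
  by move: wx; rewrite -(weight_no qx) sq addn1 ltnS.
move: wx; rewrite -(weight_yes qx); rewrite -[n.+1]addn1.
set s := \sum_(_ < _) _; have s0 : 0 < s.
  rewrite /s sumnB ?sq; last by move: qx => /andP[/forallP qx _] m' _.
  by rewrite subn_gt0 ltn_neqAle eq_sym live1.
by move=> h; rewrite -(leq_add2r 1); apply: leq_trans h; rewrite leq_add2l.
Qed.

Lemma can_end_exists (k l : nat) (x : state l) :
  (0 < k) && (0 < live x) -> exists n, can_end k n x.
Proof. by case/andP=> k0 x0; exists (weight x); apply: can_end_weight. Qed.

(* The value 0 outside k >= 1 and live x >= 1 is a dummy one: there no minimum
   need exist. *)
Definition RU (k l : nat) (x : state l) : nat :=
  match @idP ((0 < k) && (0 < live x)) with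
  | ReflectT h => ex_minn (can_end_exists h)
  | ReflectF _ => 0
  end.

Lemma RUP (k l : nat) (x : state l) : 0 < k -> 0 < live x ->
  can_end k (RU k x) x /\ (forall n, can_end k n x -> RU k x <= n).
Proof.
move=> k0 x0; rewrite /RU; case: {-}_ / idP => [h|]; last by rewrite k0 x0.
by case: ex_minnP.
Qed.

(* One element goes from component i to i - a and one from j to j + a.  The
   additions precede the truncated subtractions. *)
Definition spread (l : nat) (x : state l) (i j : 'I_l.+2) (a : nat) : state l :=
  [ffun m : 'I_l.+2 =>
     x m + (val m == i - a) + (val m == j + a) - (m == i) - (m == j)].

(* Main.v *)
Require Import Defs.
From mathcomp Require Import all_boot zify.
Set Implicit Arguments.
Unset Strict Implicit.
Unset Printing Implicit Defensive.

(* Follow individual elements instead of counts: s t is the number of NOs received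
   by t.  Pushing u from i to i - a and v from j to j + a makes the pair of
   levels of u and v more spread out (weak majorization), and the Questioner can
   keep this relation between the two games forever by copying the queries of
   the spread game, up to exchanging u and v.
   The only obstruction is that the spread game may end first, with u and v both
   live in the original one.  Two live elements take exactly one query less than
   the number of NOs they can still absorb, and the spread game already lasts
   long enough for that: it needs as many queries for u and v themselves, or for
   one of them and an element at level l, when the other is already excluded. *)

(** * The game on labelled elements and its agreement with the counted one *)

Definition alive (l : nat) (T : finType) (s : T -> nat) : nat :=
  #|[set t | s t <= l]|.

(* b = true is the answer YES. *)
Definition answer (T : finType) (s : T -> nat) (S : {set T}) (b : bool) :
  T -> nat := fun t => s t + ((t \in S) != b).

Fixpoint solves (k l : nat) (T : finType) (n : nat) (s : T -> nat) : bool :=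
  (alive l s == 1) ||
  (if n is n'.+1 then
     [exists S : {set T}, (#|S| <= k) &&
        [forall b : bool, (0 < alive l (answer s S b)) ==>
           solves k l n' (answer s S b)]]
   else false).

(** Only levels up to [l] are compared: excluded elements may rise above level l + 1, and neither
    [live] nor [legal_query] looks at them. *)
Definition counts (l : nat) (T : finType) (x : state l) (s : T -> nat) : Prop :=
  forall m : 'I_l.+1, x (inord m) = #|[set t | s t == m]|.

Lemma sum_card_levels (l : nat) (T : finType) (s : T -> nat) (A : {set T}) :
  \sum_(m < l.+1) #|[set t in A | s t == m]| = #|[set t in A | s t <= l]|.
Proof.
rewrite -sum1_card (partition_big (fun t => inord (s t) : 'I_l.+1) xpredT) //=.
apply: eq_bigr => m _; rewrite -sum1_card; apply: eq_bigl => t; rewrite !inE.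
case: (t \in A) => //=; apply/eqP/andP => [->|[sl /eqP <-]].
  by rewrite -ltnS ltn_ord inord_val.
by rewrite inordK.
Qed.

Lemma counts_live (l : nat) (T : finType) (x : state l) (s : T -> nat) :
  counts x s -> live x = alive l s.
Proof.
move=> xs; have := sum_card_levels l s setT; rewrite /alive.
rewrite [in RHS](eq_card (B := [set t | s t <= l])) => [<-|t]; last first.
  by rewrite !inE.
apply: eq_bigr => m _; rewrite xs; apply: eq_card => t.
by rewrite !inE.
Qed.

Lemma counts_answer (k l : nat) (T : finType) (x : state l) (q : query k l)
    (s : T -> nat) (S : {set T}) (b : bool) :
  counts x s -> (forall m : 'I_l.+1, q m = #|[set t in S | s t == m]| :> nat) ->
  counts (answer_state x q b) (answer s S b).
Proof.
move=> xs qS m.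
have queried (i : 'I_l.+1) : #|[set t | s t == i] :&: S| = q i.
  by rewrite qS; apply: eq_card => t; rewrite !inE andbC.
have others (i : 'I_l.+1) : #|[set t | s t == i] :\: S| = x (inord i) - q i.
  by rewrite cardsD -xs queried.
have mE : (inord m : 'I_l.+2) = m :> nat by rewrite inordK // ltnS ltnW.
have ml : m <= l by rewrite -ltnS.
rewrite -(cardsID S).
have -> : [set t | answer s S b t == m] :&: S =
    if b then [set t | s t == m] :&: S else [set t | (s t).+1 == m] :&: S.
  apply/setP=> t; case: b; rewrite !inE /answer; case: (t \in S);
    by rewrite ?andbF // ?addn0 ?addn1.
have -> : [set t | answer s S b t == m] :\: S =
    if b then [set t | (s t).+1 == m] :\: S else [set t | s t == m] :\: S.
  apply/setP=> t; case: b; rewrite !inE /answer; case: (t \in S);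
    by rewrite ?andbF // ?addn0 ?addn1.
have pred_level : 0 < m ->
    [set t | (s t).+1 == m] = [set t | s t == (inord m.-1 : 'I_l.+1)].
  move=> m0; apply/setP=> t; rewrite !inE inordK; last by lia.
  by apply/eqP/eqP; lia.
have no_level : ~~ (0 < m) -> [set t | (s t).+1 == m] = set0.
  by move=> m0; apply/setP=> t; rewrite !inE; apply/negP => /eqP; lia.
have predE : 0 < m -> inord (inord m.-1 : 'I_l.+1) = inord m.-1 :> 'I_l.+2.
  by move=> m0; rewrite inordK //; lia.
case: b; rewrite /answer_state ffunE mE ml inord_val ?queried ?others.
- congr (_ + _); case: ifP => m0; last by rewrite no_level ?m0 // set0D cards0.
  by rewrite pred_level // others predE.
- rewrite addnC; congr (_ + _).
  case: ifP => m0; last by rewrite no_level ?m0 // set0I cards0.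
  by rewrite pred_level // queried.
Qed.

Lemma subset_of_card (T : finType) (A : {set T}) (c : nat) :
  c <= #|A| -> exists2 B : {set T}, B \subset A & #|B| = c.
Proof.
move=> cA; exists [set t in take c (enum A)].
  by apply/subsetP=> t; rewrite inE => /mem_take; rewrite mem_enum.
rewrite cardsE; have /card_uniqP -> : uniq (take c (enum A)).
  exact/take_uniq/enum_uniq.
by rewrite size_takel // -cardE.
Qed.

(** Only level counts matter: [q] is realized by choosing [q m] elements at each level, and a set
    [S] is counted level by level, its excluded elements being dropped. *)
Lemma can_end_solves (k l n : nat) (T : finType) (x : state l) (s : T -> nat) :
  counts x s -> can_end k n x = solves k l n s.
Proof.
elim: n x s => [|n IHn] x s xs /=; rewrite (counts_live xs) //.
congr (_ || _); apply/existsP/existsP => [[q]|[S]] /andP[].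
- case/andP=> /forallP qx qk /forallP win.
  have slice (m : 'I_l.+1) : exists B : {set T},
      B \subset [set t | s t == m] /\ #|B| = q m.
    have [|B ? ?] := @subset_of_card _ [set t | s t == m] (q m).
      by rewrite -xs.
    by exists B.
  have [A AP] := fin_all_exists slice.
  have As m t : t \in A m -> s t = m.
    by move=> tA; have [/subsetP/(_ t tA)] := AP m; rewrite inE => /eqP.
  pose S := \bigcup_m A m.
  have qS (m : 'I_l.+1) : q m = #|[set t in S | s t == m]| :> nat.
    have [_ <-] := AP m; apply: eq_card => t; rewrite !inE.
    apply/idP/andP => [tA|[/bigcupP[m' _ tA] /eqP sm]].
      by split; [apply/bigcupP; exists m | rewrite (As _ _ tA)].
    by rewrite (_ : m = m') //; apply: val_inj; rewrite /= -sm (As _ _ tA).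
  exists S; apply/andP; split.
    rewrite (_ : #|S| = \sum_(m < l.+1) q m) // (eq_bigr _ (fun m _ => qS m)).
    rewrite sum_card_levels; apply: eq_card => t; rewrite !inE.
    case tS: (t \in S) => //=; case/bigcupP: tS => m _ /As ->.
    by rewrite -ltnS ltn_ord.
  apply/forallP=> b; have xsb := counts_answer b xs qS.
  by rewrite -(counts_live xsb) -(IHn _ _ xsb).
- move=> Sk /forallP win.
  have sumS := sum_card_levels l s S.
  have le_sum : \sum_(m < l.+1) #|[set t in S | s t == m]| <= k.
    rewrite sumS; apply: leq_trans Sk; apply: subset_leq_card.
    by apply/subsetP=> t; rewrite inE => /andP[].
  pose q : query k l := [ffun m : 'I_l.+1 => inord #|[set t in S | s t == m]|].
  have qS (m : 'I_l.+1) : q m = #|[set t in S | s t == m]| :> nat.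
    rewrite ffunE inordK // ltnS; apply: leq_trans le_sum.
    by rewrite (bigD1 m) //= leq_addr.
  exists q; apply/andP; split.
    rewrite /legal_query (eq_bigr _ (fun m _ => qS m)) le_sum andbT.
    apply/forallP=> m; rewrite qS xs; apply: subset_leq_card.
    by apply/subsetP=> t; rewrite !inE => /andP[].
  apply/forallP=> b; have xsb := counts_answer b xs qS.
  by rewrite (counts_live xsb) (IHn _ _ xsb).
Qed.

(** * Bounds on the game for two live elements *)

Lemma alive_gt0 (l : nat) (T : finType) (s : T -> nat) (t : T) :
  s t <= l -> 0 < alive l s.
Proof. by move=> st; apply/card_gt0P; exists t; rewrite inE. Qed.

Lemma alive_gt1P (l : nat) (T : finType) (s : T -> nat) :
  reflect (exists t1 t2, [/\ s t1 <= l, s t2 <= l & t1 != t2]) (1 < alive l s).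
Proof.
by apply: (iffP card_gt1P) => -[t1 [t2 []]]; rewrite ?inE => ? ? ?;
  exists t1, t2; rewrite ?inE.
Qed.

Lemma alive1_eq (l : nat) (T : finType) (s : T -> nat) (t1 t2 : T) :
  alive l s = 1 -> s t1 <= l -> s t2 <= l -> t1 = t2.
Proof.
move=> s1 st1 st2; apply/eqP/negPn/negP => t12.
by have : 1 < alive l s; [apply/alive_gt1P; exists t1, t2 | rewrite s1].
Qed.

(* With levels at most l, two live elements can still absorb
   (l + 1 - s u) + (l + 1 - s v) NOs, and the Responder can always answer so
   that at most one of these is used up per round. *)
Lemma solves_lower_bound (k l n : nat) (T : finType) (s : T -> nat) (u v : T) :
  u != v -> s u <= l -> s v <= l -> solves k l n s ->
  l.*2.+1 <= n + s u + s v.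
Proof.
move=> uv; elim: n s => [|n IHn] s su sv /=;
  (have /gtn_eqF -> /= : 1 < alive l s by apply/alive_gt1P; exists u, v) => //.
case/existsP=> S /andP[_ /forallP win].
have step b : answer s S b u <= l -> answer s S b v <= l ->
    l.*2.+1 <= n + answer s S b u + answer s S b v.
  by move=> sbu sbv; apply: IHn => //; apply: (implyP (win b));
     apply: alive_gt0 sbu.
(* If [S] separates [u] and [v], either answer gives a NO to one of them; the answer is chosen so
   that both stay live, and if both are at level l the bound is immediate. *)
have := step (u \in S); have := step (~~ (u \in S)); rewrite /answer.
by case: (u \in S); case: (v \in S) => /=; lia.
Qed.

(** Asking for [u] alone gives a NO to exactly one of [u] and [v] whatever the answer, and they
    cannot both be live once their levels sum to 2l + 1. *)
Lemma solves_pair (k l n : nat) (T : finType) (s : T -> nat) (u v : T) :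
  0 < k -> u != v -> (forall w, s w <= l -> w = u \/ w = v) ->
  0 < alive l s -> l.*2.+1 <= n + s u + s v -> solves k l n s.
Proof.
move=> k0 uv; elim: n s => [|n IHn] s only s0 lb.
all: have [/alive_gt1P[t1 [t2 [st1 st2 t12]]]|] := boolP (1 < alive l s);
  last by rewrite -leqNgt => s1 /=; rewrite eqn_leq s1 s0.
all: have /andP[su sv] : (s u <= l) && (s v <= l)
  by have [h1 h2] := (only _ st1, only _ st2);
     case: h1 h2 t12 st1 st2 => -> [] ->; rewrite ?eqxx // => _ -> ->.
  lia.
apply/orP; right; apply/existsP; exists [set u]; rewrite cards1 k0.
apply/forallP=> b; apply/implyP=> sb0; apply: IHn => //.
  by move=> w sw; apply: only; apply: leq_trans sw; apply: leq_addr.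
rewrite /answer !inE eqxx (eq_sym v) (negPf uv); case: b {sb0} => /=; lia.
Qed.

(** * Comparison of two games by weak majorization *)

(* The pair of levels of u and v in s' weakly majorizes the one in s, regardless
   of which is which.  Levels are capped at l + 1 only in s', since an excluded
   element may go on receiving NOs. *)
Definition harder (l : nat) (T : finType) (u v : T) (s' s : T -> nat) : Prop :=
  [/\ forall w, w != u -> w != v -> minn (s' w) l.+1 <= s w,
      minn (minn (s' u) (s' v)) l.+1 <= minn (s u) (s v)
    & minn (s' u) l.+1 + minn (s' v) l.+1 <= s u + s v].

Lemma harder_alive (l : nat) (T : finType) (u v : T) (s' s : T -> nat) :
  harder l u v s' s -> 0 < alive l s -> 0 < alive l s'.
Proof.
case=> hw hmin _ /card_gt0P[t]; rewrite inE => st.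
have [tu|tu] := eqVneq t u; [|have [tv|tv] := eqVneq t v];
  last by apply: (@alive_gt0 _ _ _ t); have := hw t tu tv; lia.
all: have [su|su] := leqP (s' u) l; first exact: alive_gt0 su.
all: by apply: (@alive_gt0 _ _ _ v); subst t; lia.
Qed.

(** The game on [s'] can end first only in this way: a survivor outside the pair would leave [u] and
    [v] excluded in both games, and then it alone could be live in [s]. *)
Lemma harder_lone_survivor (l : nat) (T : finType) (u v : T)
    (s' s : T -> nat) :
  harder l u v s' s -> alive l s' = 1 -> 1 < alive l s ->
  [/\ s u <= l, s v <= l & forall w, w != u -> w != v -> l < s' w].
Proof.
case=> hw hmin _ s'1 /alive_gt1P[t1 [t2 [st1 st2 t12]]].
have uniq_s' := @alive1_eq _ _ _ _ _ s'1.
have dead w : w != u -> w != v -> l < s' w.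
  move=> wu wv; rewrite ltnNge; apply/negP => s'w.
  have s'u : l < s' u.
    by rewrite ltnNge; apply: contraNN wu => /(uniq_s' _ _ s'w) ->.
  have s'v : l < s' v.
    by rewrite ltnNge; apply: contraNN wv => /(uniq_s' _ _ s'w) ->.
  have live_w t : s t <= l -> t = w.
    move=> st; apply: uniq_s' => //.
    have [tu|tu] := eqVneq t u; first by subst t; lia.
    have [tv|tv] := eqVneq t v; first by subst t; lia.
    by have := hw t tu tv; lia.
  by rewrite (live_w _ st1) (live_w _ st2) eqxx in t12.
have only t : s t <= l -> t = u \/ t = v.
  move=> st; have [->|tu] := eqVneq t u; first by left.
  have [->|tv] := eqVneq t v; first by right.
  by have := hw t tu tv; have := dead t tu tv; lia.
have [h1 h2] := (only _ st1, only _ st2).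
by case: h1 h2 t12 st1 st2 => -> [] ->; rewrite ?eqxx.
Qed.

(** Weak majorization survives when the lower members of the two pairs receive the same NOs, and so
    do the higher ones. The last claim records that an exchange of [u] and [v] keeps the total
    received by the pair. *)
Lemma harder_query (l : nat) (T : finType) (u v : T) (s' s : T -> nat)
    (S' : {set T}) :
  u != v -> harder l u v s' s ->
  exists S : {set T}, [/\ #|S| = #|S'|,
    forall b, harder l u v (answer s' S' b) (answer s S b)
  & forall b, answer s S b u + answer s S b v =
      s u + s v + ((u \in S') != b) + ((v \in S') != b)].
Proof.
move=> uv [hw hmin hsum].
(* S is S', with u and v exchanged if they are ordered differently in s'. *)
have [same|flip] := boolP ((s' u <= s' v) == (s u <= s v)).
  exists S'; split=> // b; last by rewrite /answer; lia.
  split; rewrite /answer.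
  - by move=> w wu wv; have := hw w wu wv; lia.
  - by case: (u \in S'); case: (v \in S'); case: b => /=; lia.
  - by case: (u \in S'); case: (v \in S'); case: b => /=; lia.
pose f t := if t == u then v else if t == v then u else t.
have fK : involutive f.
  move=> t; rewrite /f; have [->|tu] := eqVneq t u.
    by rewrite eq_sym (negPf uv) eqxx.
  have [->|tv] := eqVneq t v; first by rewrite eqxx.
  by rewrite (negPf tu) (negPf tv).
have Su : (u \in f @^-1: S') = (v \in S') by rewrite inE /f eqxx.
have Sv : (v \in f @^-1: S') = (u \in S').
  by rewrite inE /f eq_sym (negPf uv) eqxx.
exists (f @^-1: S'); split=> [|b|b].
- apply: on_card_preimset; apply: onW_bij; exact: inv_bij.
- split; rewrite /answer ?Su ?Sv.
  + move=> w wu wv; have := hw w wu wv.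
    by rewrite inE /f (negPf wu) (negPf wv); lia.
  + by case: (u \in S'); case: (v \in S'); case: b => /=; lia.
  + by case: (u \in S'); case: (v \in S'); case: b => /=; lia.
- by rewrite /answer Su Sv; lia.
Qed.

(** Treats the round that ends the game on [s']: the bound is what [solves_pair] needs to finish [u]
    and [v] in the [n] rounds left. *)
Lemma harder_lower_bound (k l n : nat) (T : finType) (u v : T)
    (s' s : T -> nat) (S' : {set T}) (b : bool) :
  u != v -> harder l u v s' s -> alive l s' != 1 -> solves k l n.+1 s' ->
  alive l (answer s' S' b) = 1 ->
  (forall w, w != u -> w != v -> l < answer s' S' b w) ->
  l.*2.+1 <= n + (s u + s v + ((u \in S') != b) + ((v \in S') != b)).
Proof.
move=> uv [_ _ hsum] s'1 sol s'b1 dead.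
have [|] := boolP ((s' u <= l) && (s' v <= l)).
  (* The answer excludes [u] or [v], and the NO given for this makes up for the round spent. *)
  case/andP=> s'u s'v; have := solves_lower_bound uv s'u s'v sol.
  have : ~~ ((answer s' S' b u <= l) && (answer s' S' b v <= l)).
    by apply: contraNN uv => /andP[au av]; rewrite (alive1_eq s'b1 au av).
  by rewrite /answer; lia.
(* Otherwise [u] or [v] is already excluded and counts l + 1 in [hsum]; the bound comes from the
   survivor [w] and a second live element [t]. *)
have le_answer t : s' t <= answer s' S' b t by exact: leq_addr.
have [w] : exists w, answer s' S' b w <= l.
  have /card_gt0P[w] : 0 < #|[set t | answer s' S' b t <= l]|.
    by rewrite -/(alive l _) s'b1.
  by rewrite inE; exists w.
move=> sbw; have w_uv : w = u \/ w = v.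
  have [->|wu] := eqVneq w u; first by left.
  have [->|wv] := eqVneq w v; first by right.
  by have := dead w wu wv; lia.
have s'w : s' w <= l := leq_trans (le_answer w) sbw.
have /alive_gt1P[t1 [t2 [st1 st2 t12]]] : 1 < alive l s'.
  by rewrite ltn_neqAle eq_sym s'1 (alive_gt0 s'w).
have [t tw s't] : exists2 t, t != w & s' t <= l.
  have [t1w|] := eqVneq t1 w; last by exists t1.
  by exists t2; rewrite // -t1w eq_sym.
have bound := solves_lower_bound tw s't s'w sol.
move=> dead_uv.
have tu : t != u.
  apply/eqP=> tu; case: w_uv => wE; first by rewrite tu wE eqxx in tw.
  by rewrite -wE -tu s'w s't in dead_uv.
have tv : t != v.
  apply/eqP=> tv; case: w_uv => wE; last by rewrite tv wE eqxx in tw.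
  by rewrite -wE -tv s'w s't in dead_uv.
(* Live before this answer and excluded by it, [t] is at level exactly l. *)
have := dead t tu tv; rewrite {1}/answer => s'tl.
clear -w_uv s'tl s't s'w hsum bound dead_uv.
by move: hsum dead_uv; case: w_uv => <-; rewrite s'w; lia.
Qed.

(** The assumed bound concerns only a game on [s'] that is over at the start; after each round
    [harder_lower_bound] supplies it anew. *)
Lemma solves_harder (k l n : nat) (T : finType) (u v : T) (s' s : T -> nat) :
  0 < k -> u != v -> harder l u v s' s -> 0 < alive l s ->
  (alive l s' = 1 -> 1 < alive l s -> l.*2.+1 <= n + s u + s v) ->
  solves k l n s' -> solves k l n s.
Proof.
move=> k0 uv; elim: n s' s => [|n IHn] s' s hs s0 exceptional sol.
all: have [s1|/negbTE sN1] := eqVneq (alive l s) 1; first by rewrite /= s1.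
all: have s_gt1 : 1 < alive l s by rewrite ltn_neqAle eq_sym sN1.
all: have [s'1|s'N1] := eqVneq (alive l s') 1.
(* The game on [s'] is over and the one on [s] is not: only [u] and [v] are live there. *)
1,3: apply: (solves_pair k0 uv) (exceptional s'1 s_gt1) => // w sw.
1,2: have [_ _ dead] := harder_lone_survivor hs s'1 s_gt1.
1,2: have [->|wu] := eqVneq w u; first by left.
1,2: have [->|wv] := eqVneq w v; first by right.
1,2: by case: hs => /(_ w wu wv) + _ _; have := dead w wu wv; lia.
  by move: sol; rewrite /= (negbTE s'N1).
move: (sol); rewrite /= (negbTE s'N1) sN1 /= => /existsP[S' /andP[S'k win]].
have [S [S_S' hb incr]] := harder_query S' uv hs.
apply/existsP; exists S; rewrite S_S' S'k; apply/forallP=> b; apply/implyP=> sb0.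
have sb'0 := harder_alive (hb b) sb0.
apply: IHn (hb b) sb0 _ (implyP (forallP win b) sb'0) => sb'1 sb_gt1.
have [_ _ dead] := harder_lone_survivor (hb b) sb'1 sb_gt1.
rewrite -addnA incr.
exact: (harder_lower_bound uv hs s'N1 sol sb'1 dead).
Qed.

(** * Realization of states by elements, and the theorem *)

Lemma counts_tag (l : nat) (x : state l) :
  counts x (fun t : {m : 'I_l.+2 & 'I_(x m)} => tag t : nat).
Proof.
move=> m; set m2 : 'I_l.+2 := inord m.
have mE : m2 = m :> nat by rewrite inordK // ltnS ltnW.
have Tagged_inj : injective (@Tagged _ m2 (fun m => 'I_(x m))).
  by move=> c d /eqP; rewrite eq_Tagged => /eqP.
rewrite -[LHS]card_ord -(card_imset _ Tagged_inj); apply: eq_card => t.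
rewrite inE -mE val_eqE; apply/imsetP/eqP => [[c _ ->] //|tm].
by case: t tm => m' c /= m'E; subst m'; exists c.
Qed.

Lemma card_level_pair (T : finType) (s : T -> nat) (u v : T) (m : nat) :
  u != v ->
  #|[set t | s t == m]| =
    (s u == m) + (s v == m) + #|[set t | s t == m] :\ u :\ v|.
Proof.
move=> uv; have vu : v != u by rewrite eq_sym.
by rewrite (cardsD1 u) (cardsD1 v (_ :\ u)) !inE vu addnA.
Qed.

Theorem lemma3 (k l : nat) (x : state l) (i j : 'I_l.+2) (a : nat) :
  1 <= k -> 1 <= l ->
  1 <= i -> i <= j -> j <= l ->
  1 <= x i -> 1 <= x j -> (i = j -> 2 <= x i) ->
  1 <= a <= minn i (l - j + 1) ->
  ~ (live x = 2 /\ a = l - j + 1) ->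
  RU k x <= RU k (spread x i j a).
Proof.
move=> k0 _ _ ij jl xi xj xij /andP[_ a_le] not_exceptional.
pose T := {m : 'I_l.+2 & 'I_(x m)}.
pose s (t : T) : nat := tag t.
have xs : counts x s by exact: counts_tag.
have x_level (m : 'I_l.+2) : m <= l -> x m = #|[set t | s t == m]|.
  by move=> ml; have := xs (inord m); rewrite inordK // inord_val.
have il := leq_trans ij jl.
have [u /eqP su] : exists u, s u == i.
  by move: xi; rewrite x_level // => /card_gt0P[u]; rewrite inE; exists u.
have [v uv sv] : exists2 v, u != v & s v = j.
  have /card_gt0P[v] : 0 < #|[set t | s t == j] :\ u|.
    have := cardsD1 u [set t | s t == j]; rewrite -x_level // inE su val_eqE.
    have [ij_eq|_] := eqVneq i j; last by lia.
    by have := xij ij_eq; rewrite -ij_eq; lia.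
  by rewrite !inE eq_sym => /andP[uv /eqP sv]; exists v.
pose s' t := if t == u then i - a else if t == v then j + a else s t.
have s'u : s' u = i - a by rewrite /s' eqxx.
have s'v : s' v = j + a by rewrite /s' eq_sym (negbTE uv) eqxx.
have s'w w : w != u -> w != v -> s' w = s w.
  by rewrite /s' => /negbTE -> /negbTE ->.
have xs' : counts (spread x i j a) s'.
  move=> m; rewrite ffunE (xs m) !(card_level_pair _ _ uv) su sv s'u s'v.
  rewrite -!val_eqE /= inordK; last by rewrite ltnS ltnW.
  rewrite (_ : [set t | s' t == m] :\ u :\ v = [set t | s t == m] :\ u :\ v).
    (* The elements other than [u] and [v] contribute the same [c] to both sides. Truncation is
       harmless, since the subtracted indicators are summands of the original count. *)
    set c := #|_|; rewrite ![_ == nat_of_ord m]eq_sym.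
    by do 4 move: (nat_of_bool _) => ?; lia.
  apply/setP=> t; rewrite !inE; have [//|tv] := eqVneq t v.
  by have [//|tu] := eqVneq t u; rewrite s'w.
have s0 : 0 < alive l s by apply: (@alive_gt0 _ _ _ u); rewrite su.
have s'0 : 0 < alive l s' by apply: (@alive_gt0 _ _ _ u); rewrite s'u; lia.
have hs : harder l u v s' s.
  split; rewrite ?s'u ?s'v ?su ?sv; try lia.
  by move=> w wu wv; rewrite s'w // geq_minl.
have x0 : 0 < live x by rewrite (counts_live xs).
have x'0 : 0 < live (spread x i j a) by rewrite (counts_live xs').
have [win' _] := RUP k0 x'0; have [_ RU_min] := RUP k0 x0.
apply: RU_min; move: win'; rewrite (can_end_solves _ _ xs) (can_end_solves _ _ xs').
(* If the spread game is over at once, only [u] and [v] are live in [x], and [v] has been pushed to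
   level l + 1: this is the excluded case. *)
apply: (solves_harder k0 uv hs s0) => s'1 s_gt1.
have [_ _ dead] := harder_lone_survivor hs s'1 s_gt1.
case: not_exceptional; split.
  apply/eqP; rewrite (counts_live xs) eqn_leq s_gt1 andbT.
  have <- : #|[set u; v]| = 2 by rewrite cards2 uv.
  apply: subset_leq_card; apply/subsetP=> t; rewrite !inE => st.
  apply: contraLR st; rewrite negb_or -ltnNge => /andP[tu tv].
  by rewrite -s'w // dead.
have : ~~ (s' v <= l).
  by apply: contraNN uv => s'vl; apply/eqP/(alive1_eq s'1); rewrite // s'u; lia.
by rewrite s'v; lia.
Qed.
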